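(* Let $\mathfrak n$ be the 9-dimensional real Lie algebra with basis $p_1,p_2,\ell_1,\ell_2,s_0,a,u_1,u_2,b$ whose only nonzero brackets, apart from those following by skew-symmetry, are $$[p_1,p_2]=a,\quad [p_1,a]=u_1,\quad [p_2,a]=u_2,\quad [p_1,u_1]=-b,\quad [p_2,u_2]=-b,$$ $$[p_1,s_0]=u_1,\quad [p_2,s_0]=u_2,\quad [p_1,\ell_2]=b,\quad [p_2,\ell_1]=-b,$$ with the metric of signature $(6,3)$ whose nonzero pairings are $$\langle p_i,\ell_j\rangle=\delta_{ij},\quad \langle a,b\rangle=1,\quad \langle s_0,s_0\rangle=\langle u_1,u_1\rangle=\langle u_2,u_2\rangle=1 .$$ Then the metric Lie algebra $(\mathfrak n,\langle\cdot,\cdot\rangle)$ is four-step nilpotent and GO. Moreover, writing $T\in\mathfrak n$ as $T=(p,\ell,y,x,u,\beta)$ with $p,\ell,u\in\mathbb R^2$ the coordinates with respect to $(p_1,p_2)$, $(\ell_1,\ell_2)$, $(u_1,u_2)$ and $y,x,\beta\in\mathbb R$ the coordinates of $s_0,a,b$ respectively, and putting $J=\begin{pmatrix}0&1\\-1&0\end{pmatrix}$, a linear geodesic graph is $$D(T)=\mathcal A(-x,\,-p+Ju,\,y-\beta),$$ where for $r,z\in\mathbb R$ and $w\in\mathbb R^2$, $$\mathcal A(r,w,z)(p,\ell,y,x,u,\beta)=\bigl(rJp,\ rJ\ell+yJw+zJp,\ w^tJp,\ 0,\ rJu+xw,\ -w^tu\bigr).$$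
   Context: A metric nilpotent Lie algebra $(\mathfrak n,\langle\cdot,\cdot\rangle)$ ($\langle\cdot,\cdot\rangle$ a nondegenerate symmetric bilinear form) is GO with respect to a Lie algebra $\mathfrak h$ of skew-adjoint derivations of $\mathfrak n$ if for every $T\in\mathfrak n$ there exist $A\in\mathfrak h$ and $k\in\mathbb R$ with $\langle [T,T']+AT',T\rangle=k\langle T,T'\rangle$ for all $T'\in\mathfrak n$. It is called GO if this holds for some such $\mathfrak h$. Here $\mathfrak h$ is the set of all maps $\mathcal A(r,w,z)$, $r,z\in\mathbb R$, $w\in\mathbb R^2$, which is a four-dimensional Lie algebra of skew-adjoint derivations of $\mathfrak n$. A linear geodesic graph is a linear map $D:\mathfrak n\to\mathfrak h$ such that $\langle [T,T']+D(T)T',T\rangle=0$ for all $T,T'\in\mathfrak n$ (i.e. the GO condition with $A=D(T)$, $k=0$, including all null $T$). *)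

(* Defs.v *)
From HB Require Import structures.
From mathcomp Require Import all_boot all_order all_algebra.
From mathcomp Require Import ring.
From mathcomp Require Import reals.

Set Implicit Arguments.
Unset Strict Implicit.
Unset Printing Implicit Defensive.

Import GRing.Theory.
Local Open Scope ring_scope.

Section MetricLieAlgebra.
Variables (R : realType) (V : vectType R).
Implicit Types (br : V -> V -> V) (B : V -> V -> R) (h U W : {vspace V}).

Definition is_lie_bracket br : Prop :=
  [/\ bilinear_for *:%R *:%R br,
      forall x, br x x = 0
    & forall x y z, br x (br y z) + br y (br z x) + br z (br x y) = 0].

Definition is_metric B : Prop :=
  [/\ bilinear_for *%R *%R B,
      forall x y, B x y = B y x
    & forall x, (forall y, B x y = 0) -> x = 0].

(* p plus signs followed by q minus signs in a pseudo-orthonormal basis. *)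
Definition has_signature B (p q : nat) : Prop :=
  exists2 e : (p + q).-tuple V, basis_of {:V}%VS e &
    forall i j : 'I_(p + q),
      B (tnth e i) (tnth e j) =
        if i == j then (if (i < p)%N then 1 else -1) else 0.

(* For bilinear br this is the span of all br x y with x in U and y in W. *)
Definition bracketv br U W : {vspace V} :=
  <<[seq br x y | x <- vbasis U, y <- vbasis W]>>%VS.

Definition lower_central br (k : nat) : {vspace V} :=
  iter k (bracketv br {:V}%VS) {:V}%VS.

Definition step_nilpotent br (s : nat) : Prop :=
  lower_central br s = 0%VS /\
  forall k, (k < s)%N -> lower_central br k <> 0%VS.

Definition is_derivation br (A : 'End(V)) : Prop :=
  forall x y, A (br x y) = br (A x) y + br x (A y).

Definition is_skew_adjoint B (A : 'End(V)) : Prop :=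
  forall x y, B (A x) y = - B x (A y).

(* Lie subalgebras of 'End(V), for the commutator, that consist of
   skew-adjoint derivations. *)
Definition is_skew_derivation_algebra br B (h : {vspace 'End(V)}) : Prop :=
  (forall A, A \in h -> is_derivation br A /\ is_skew_adjoint B A) /\
  (forall A A', A \in h -> A' \in h ->
    (A \o A')%VF - (A' \o A)%VF \in h).

Definition GO_with br B (h : {vspace 'End(V)}) : Prop :=
  forall T, exists A : 'End(V), exists k : R,
    A \in h /\ forall T', B (br T T' + A T') T = k * B T T'.

Definition is_GO br B : Prop :=
  exists h : {vspace 'End(V)},
    is_skew_derivation_algebra br B h /\ GO_with br B h.

Definition linear_geodesic_graph br B (h : {vspace 'End(V)})
    (D : V -> 'End(V)) : Prop :=
  [/\ linear D, forall T, D T \in h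
    & forall T T', B (br T T' + D T T') T = 0].

End MetricLieAlgebra.

Section NineDimensionalExample.
Variable R : realType.

Local Notation n := 'rV[R]_9.

Definition ip1 : 'I_9 := @Ordinal 9 0 isT.
Definition ip2 : 'I_9 := @Ordinal 9 1 isT.
Definition il1 : 'I_9 := @Ordinal 9 2 isT.
Definition il2 : 'I_9 := @Ordinal 9 3 isT.
Definition is0 : 'I_9 := @Ordinal 9 4 isT.
Definition ia  : 'I_9 := @Ordinal 9 5 isT.
Definition iu1 : 'I_9 := @Ordinal 9 6 isT.
Definition iu2 : 'I_9 := @Ordinal 9 7 isT.
Definition ib  : 'I_9 := @Ordinal 9 8 isT.

Definition e (i : 'I_9) : n := delta_mx 0 i.

(* The skew-symmetric bilinear extension of the bracket table
   [p1,p2] = a, [p1,a] = u1, [p2,a] = u2, [p1,u1] = -b, [p2,u2] = -b,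
   [p1,s0] = u1, [p2,s0] = u2, [p1,l2] = b, [p2,l1] = -b:
   each entry [e i, e j] = v contributes (T_i T'_j - T_j T'_i) v. *)
Definition lie_br (T T' : n) : n :=
  let m i j := T 0 i * T' 0 j - T 0 j * T' 0 i in
    m ip1 ip2 *: e ia
  + m ip1 ia *: e iu1
  + m ip2 ia *: e iu2
  + m ip1 iu1 *: - e ib
  + m ip2 iu2 *: - e ib
  + m ip1 is0 *: e iu1
  + m ip2 is0 *: e iu2
  + m ip1 il2 *: e ib
  + m ip2 il1 *: - e ib.

Definition metric (T T' : n) : R :=
    (T 0 ip1 * T' 0 il1 + T 0 il1 * T' 0 ip1)
  + (T 0 ip2 * T' 0 il2 + T 0 il2 * T' 0 ip2)
  + (T 0 ia * T' 0 ib + T 0 ib * T' 0 ia)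
  + T 0 is0 * T' 0 is0
  + T 0 iu1 * T' 0 iu1
  + T 0 iu2 * T' 0 iu2.

Definition col2 (c d : R) : 'cV[R]_2 := \col_i (if i == 0 then c else d).

Definition crd_p (T : n) : 'cV[R]_2 := col2 (T 0 ip1) (T 0 ip2).
Definition crd_l (T : n) : 'cV[R]_2 := col2 (T 0 il1) (T 0 il2).
Definition crd_y (T : n) : R := T 0 is0.
Definition crd_x (T : n) : R := T 0 ia.
Definition crd_u (T : n) : 'cV[R]_2 := col2 (T 0 iu1) (T 0 iu2).
Definition crd_beta (T : n) : R := T 0 ib.

(* The vector written (p, l, y, x, u, beta). *)
Definition mkn (p l : 'cV[R]_2) (y x : R) (u : 'cV[R]_2) (beta : R) : n :=
    p 0 0 *: e ip1 + p 1 0 *: e ip2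
  + l 0 0 *: e il1 + l 1 0 *: e il2
  + y *: e is0 + x *: e ia
  + u 0 0 *: e iu1 + u 1 0 *: e iu2
  + beta *: e ib.

(* The matrix with rows (0, 1) and (-1, 0). *)
Definition J : 'M[R]_2 := delta_mx 0 1 - delta_mx 1 0.

Definition calA_fun (r : R) (w : 'cV[R]_2) (z : R) (T : n) : n :=
  let p := crd_p T in let l := crd_l T in let y := crd_y T in
  let x := crd_x T in let u := crd_u T in
  mkn (r *: (J *m p))
      (r *: (J *m l) + y *: (J *m w) + z *: (J *m p))
      ((w^T *m J *m p) 0 0)
      0
      (r *: (J *m u) + x *: w)
      (- (w^T *m u) 0 0).

Local Lemma sum2E (F : 'I_2 -> R) : \sum_(i < 2) F i = F 0 + F 1.
Proof. by rewrite big_ord_recl big_ord1; congr (_ + F _); apply/val_inj. Qed.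

Fact calA_fun_linear r w z : linear (calA_fun r w z).
Proof.
move=> k T T'; apply/rowP => i.
rewrite !mxE !sum2E !mxE !sum2E !mxE /= /crd_x /crd_y !mxE.
ring.
Qed.

HB.instance Definition _ r w z :=
  GRing.isLinear.Build R n n _ (calA_fun r w z) (calA_fun_linear r w z).

Definition calA (r : R) (w : 'cV[R]_2) (z : R) : 'End(n) :=
  linfun (calA_fun r w z).

Definition geodesic_graph (T : n) : 'End(n) :=
  calA (- crd_x T) (- crd_p T + J *m crd_u T) (crd_y T - crd_beta T).

End NineDimensionalExample.

(* Main.v *)
(* Everything is checked in coordinates.  The k-th term of the lower central
   series has vanishing (p, l, y)-coordinates for k = 1, also vanishing x for
   k = 2, also vanishing u for k = 3, and is 0 for k = 4, while ad(p1)^k p2 is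
   nonzero for k < 4.  The operators calA are closed under commutators by
     [A(r, w, z), A(r', w', z')] = A(0, J (r w' - r' w), w2 w1' - w1 w2'),
   and being GO follows from the linear geodesic graph, with k = 0. *)
Require Import Defs.
From HB Require Import structures.
From mathcomp Require Import all_boot all_order all_algebra.
From mathcomp Require Import ring lra.
From mathcomp Require Import reals.

Import GRing.Theory Num.Theory.
Local Open Scope ring_scope.

(** * Spans of brackets *)

Section Bracket.
Variables (R : realType) (V : vectType R) (br : V -> V -> V).
Implicit Types U W : {vspace V}.

(** [bracketv] is spanned by brackets of basis vectors, and [f] vanishes on these generators.
    Applied to coordinate functionals, this bounds the lower central series from above. *)
Lemma linear_eq0_on_bracketv (K : lmodType R) (f : V -> K) U W :
  linear f -> (forall x y, x \in U -> y \in W -> f (br x y) = 0) ->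
  forall v, v \in bracketv br U W -> f v = 0.
Proof.
move=> f_lin f0 v; pose g_lin := GRing.isLinear.Build _ _ _ _ f f_lin.
pose g : {linear V -> K} := HB.pack f g_lin; rewrite -[f v]/(g v).
rewrite /bracketv -[X in span X]/(tval (in_tuple _)).
move/coord_span => ->; rewrite linear_sum big1 // => i _.
rewrite linearZ; set y := (X in g X).
have /allpairsP[[x1 x2] /= [x1U x2W ->]] :
    y \in [seq br x y | x <- vbasis U, y <- vbasis W] by exact: mem_nth.
by rewrite /= f0 ?scaler0 // vbasis_mem.
Qed.

Hypothesis br_bilin : bilinear_for *:%R *:%R br.

(** Expanding both arguments in the chosen bases leaves a combination of the generators. This bounds
    the lower central series from below. *)
Lemma mem_bracketv U W x y :
  x \in U -> y \in W -> br x y \in bracketv br U W.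
Proof.
case: br_bilin => br_l br_r xU yW.
pose bl z := GRing.isLinear.Build _ _ _ _ (br ^~ z) (br_l z).
pose fl z : {linear V -> V} := HB.pack (br ^~ z) (bl z).
pose r z := GRing.isLinear.Build _ _ _ _ (br z) (br_r z).
pose fr z : {linear V -> V} := HB.pack (br z) (r z).
rewrite (coord_vbasis xU) -[br _ y]/(fl y _) linear_sum rpred_sum // => i _.
rewrite linearZ rpredZ //= (coord_vbasis yW) -[br _ _]/(fr _ _) linear_sum.
rewrite rpred_sum // => j _; rewrite linearZ rpredZ //= memv_span //.
by apply: allpairs_f; rewrite mem_nth ?size_tuple.
Qed.

End Bracket.

(** Pairing a vanishing combination with the [i]-th vector leaves only its [i]-th coefficient times
    a nonzero square. *)
Lemma orthogonal_free (R : realType) (V : vectType R) (B : V -> V -> R) m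
    (X : m.-tuple V) :
  bilinear_for *%R *%R B ->
  (forall i j, i != j -> B (tnth X i) (tnth X j) = 0) ->
  (forall i, B (tnth X i) (tnth X i) != 0) -> free X.
Proof.
move=> [B_lin _] Xorth Xnz; apply/freeP => k kX0 i.
pose Bi_lin := GRing.isLinear.Build _ _ _ _ (B ^~ (tnth X i)) (B_lin _).
pose Bi : {linear V -> R^o} := HB.pack (B ^~ (tnth X i)) Bi_lin.
have : Bi (\sum_j k j *: X`_j) = 0 by rewrite kX0 linear0.
rewrite linear_sum (bigD1 i) // big1 => [|j ji]; last first.
  by rewrite linearZ -tnth_nth /= Xorth ?scaler0.
rewrite linearZ -tnth_nth /= addr0 => /eqP.
by rewrite scaler_eq0 (negbTE (Xnz i)) orbF => /eqP.
Qed.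

(** * Coordinates of vectors, brackets and operators *)

Section RowVectors.
Variable R : realType.
Local Notation n := 'rV[R]_9.
Implicit Types T : n.

Lemma rV9P T T' :
  T 0 ip1 = T' 0 ip1 -> T 0 ip2 = T' 0 ip2 -> T 0 il1 = T' 0 il1 ->
  T 0 il2 = T' 0 il2 -> T 0 is0 = T' 0 is0 -> T 0 ia = T' 0 ia ->
  T 0 iu1 = T' 0 iu1 -> T 0 iu2 = T' 0 iu2 -> T 0 ib = T' 0 ib -> T = T'.
Proof.
move=> ? ? ? ? ? ? ? ? ?; apply/rowP.
(* Replacing the bound proof by [isT] turns each index into one of the named ordinals. *)
by case=> [[|[|[|[|[|[|[|[|[|//]]]]]]]]] i]; rewrite (bool_irrelevance i isT).
Qed.

Lemma lie_brE (T T' : n) (m := fun i j => T 0 i * T' 0 j - T 0 j * T' 0 i) :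
  (lie_br T T' 0 ip1 = 0) * (lie_br T T' 0 ip2 = 0) *
  (lie_br T T' 0 il1 = 0) * (lie_br T T' 0 il2 = 0) *
  (lie_br T T' 0 is0 = 0) * (lie_br T T' 0 ia = m ip1 ip2) *
  (lie_br T T' 0 iu1 = m ip1 ia + m ip1 is0) *
  (lie_br T T' 0 iu2 = m ip2 ia + m ip2 is0) *
  (lie_br T T' 0 ib = m ip1 il2 - m ip2 il1 - m ip1 iu1 - m ip2 iu2).
Proof. by rewrite /m; do !split; rewrite !mxE /=; ring. Qed.

Lemma rV9_eq0 T :
  T 0 ip1 = 0 -> T 0 ip2 = 0 -> T 0 il1 = 0 -> T 0 il2 = 0 -> T 0 is0 = 0 ->
  T 0 ia = 0 -> T 0 iu1 = 0 -> T 0 iu2 = 0 -> T 0 ib = 0 -> T = 0.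
Proof. by move=> *; apply: rV9P; rewrite mxE. Qed.

Lemma sum_ord2 (F : 'I_2 -> R) : \sum_(i < 2) F i = F 0 + F 1.
Proof. by rewrite big_ord_recl big_ord1; congr (_ + F _); apply/val_inj. Qed.

Lemma mul_J (w : 'cV[R]_2) :
  ((J R *m w) 0 0 = w 1 0) * ((J R *m w) 1 0 = - w 0 0).
Proof. by split; rewrite mxE sum_ord2 !mxE /=; ring. Qed.

Lemma calAE r w z (T : n) :
  (calA r w z T 0 ip1 = r * T 0 ip2) *
  (calA r w z T 0 ip2 = - (r * T 0 ip1)) *
  (calA r w z T 0 il1 = r * T 0 il2 + T 0 is0 * w 1 0 + z * T 0 ip2) *
  (calA r w z T 0 il2 = - (r * T 0 il1 + T 0 is0 * w 0 0 + z * T 0 ip1)) *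
  (calA r w z T 0 is0 = w 0 0 * T 0 ip2 - w 1 0 * T 0 ip1) *
  (calA r w z T 0 ia = 0) *
  (calA r w z T 0 iu1 = r * T 0 iu2 + T 0 ia * w 0 0) *
  (calA r w z T 0 iu2 = - (r * T 0 iu1) + T 0 ia * w 1 0) *
  (calA r w z T 0 ib = - (w 0 0 * T 0 iu1 + w 1 0 * T 0 iu2)).
Proof.
rewrite /calA; do !split; rewrite lfunE /= /calA_fun /mkn.
all: by rewrite !mxE !sum_ord2 !mxE !sum_ord2 !mxE /= /crd_x /crd_y; ring.
Qed.

(** * Lie algebra axioms and nilpotency *)

Lemma lie_br_bilinear : bilinear_for *:%R *:%R (@lie_br R).
Proof.
by split=> T k T1 T2; apply: rV9P; rewrite !(lie_brE, mxE); ring.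
Qed.

Lemma lie_br_lie : is_lie_bracket (@lie_br R).
Proof.
split; first exact: lie_br_bilinear.
  by move=> T; apply: rV9_eq0; rewrite lie_brE; ring.
move=> T T1 T2.
(* Here and below, each bracket and each value of calA is replaced by a variable
   with known coordinates, because unification would otherwise unfold it. *)
move: (lie_br T1 T2) (lie_brE T1 T2) (lie_br T2 T) (lie_brE T2 T)
  (lie_br T T1) (lie_brE T T1) => X XE Y YE Z ZE.
move: (lie_br T X) (lie_brE T X) (lie_br T1 Y) (lie_brE T1 Y)
  (lie_br T2 Z) (lie_brE T2 Z) => U UE V VE W WE.
by apply: rV9_eq0; rewrite !mxE UE VE WE ?(XE, YE, ZE); ring.
Qed.

Lemma lie_br_step_nilpotent : step_nilpotent (@lie_br R) 4.
Proof.
pose L := lower_central (@lie_br R).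
(* [L 0] is the whole algebra, so [L k.+1] is spanned by brackets whose second entry lies in
   [L k]. *)
have L_coord0 k i : (forall x y, y \in L k -> lie_br x y 0 i = 0) ->
    forall v, v \in L k.+1 -> v 0 i = 0.
  move=> br0; apply: (@linear_eq0_on_bracketv _ _ _ R^o (fun v : n => v 0 i)).
    by move=> c v v'; rewrite !mxE.
  by move=> x y _; apply: br0.
(* This and the next three facts are stated for every deeper term as well, so that each one can
   reuse the earlier ones one level down. *)
have L1 k v : v \in L k.+1 -> (v 0 ip1 = 0) * (v 0 ip2 = 0) *
    (v 0 il1 = 0) * (v 0 il2 = 0) * (v 0 is0 = 0).
  by move=> vL; do !split; apply: L_coord0 vL => x y _; rewrite lie_brE.
have L2 k v : v \in L k.+2 -> v 0 ia = 0.
  by apply: L_coord0 => x y yL; rewrite lie_brE !(L1 _ _ yL); ring.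
have L3 k v : v \in L k.+3 -> (v 0 iu1 = 0) * (v 0 iu2 = 0).
  move=> vL; split; apply: L_coord0 vL => x y yL;
  by rewrite lie_brE !(L1 _ _ yL) (L2 _ _ yL); ring.
have L4 k v : v \in L k.+4 -> v 0 ib = 0.
  apply: L_coord0 => x y yL.
  by rewrite lie_brE !(L1 _ _ yL) !(L3 _ _ yL); ring.
split=> [|k k4 Lk0].
  apply/eqP; rewrite -subv0; apply/subvP => v vL; rewrite memv0; apply/eqP.
  apply: rV9_eq0;
  by rewrite ?(L1 _ _ vL) ?(L3 _ _ vL) ?(L2 _ _ vL) ?(L4 _ _ vL).
(* The chain runs p2, a, u1, -b, hence the coordinates tested below. *)
pose z j := iter j (lie_br (e R ip1)) (e R ip2).
have zL j : z j \in L j.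
  elim: j => [|j IHj]; first exact: memvf.
  by apply: mem_bracketv => //; [exact: lie_br_bilinear | exact: memvf].
have {zL Lk0}zk0 i : z k 0 i = 0.
  suff -> : z k = 0 by rewrite mxE.
  by apply/eqP; rewrite -memv0 -Lk0 zL.
have [z0 z1] : z 0%N 0 ip2 = 1 /\ z 1%N 0 ia = 1.
  by rewrite /z /= lie_brE !mxE /=; split; ring.
have z2 : z 2%N 0 iu1 = 1 by rewrite /z /= !lie_brE !mxE /=; ring.
have z3 : z 3%N 0 ib = -1 by rewrite /z /= !lie_brE !mxE /=; ring.
case: k k4 zk0 => [|[|[|[|//]]]] _ zk0.
- by move: (zk0 ip2); rewrite z0; lra.
- by move: (zk0 ia); rewrite z1; lra.
- by move: (zk0 iu1); rewrite z2; lra.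
- by move: (zk0 ib); rewrite z3; lra.
Qed.

(** * The metric and its signature *)

Lemma metric_e (T : n) :
  (metric T (e R ip1) = T 0 il1) * (metric T (e R ip2) = T 0 il2) *
  (metric T (e R il1) = T 0 ip1) * (metric T (e R il2) = T 0 ip2) *
  (metric T (e R is0) = T 0 is0) * (metric T (e R ia) = T 0 ib) *
  (metric T (e R iu1) = T 0 iu1) * (metric T (e R iu2) = T 0 iu2) *
  (metric T (e R ib) = T 0 ia).
Proof. by do !split; rewrite /metric !mxE /=; ring. Qed.

Lemma metric_bilinear : bilinear_for *%R *%R (@metric R).
Proof. by split=> T k T1 T2 /=; rewrite /metric !mxE; ring. Qed.

Lemma metric_nondegenerate : is_metric (@metric R).
Proof.
split; first exact: metric_bilinear; first by move=> T T'; rewrite /metric; ring.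
by move=> T T0; apply: rV9P; rewrite mxE -?(metric_e T) T0.
Qed.

Lemma metric_signature : has_signature (@metric R) 6 3.
Proof.
(* In each hyperbolic plane (p1, l1), (p2, l2), (a, b), the vectors with parameters c and c' have
   product c + c'. So 1/2 and -1/2 give orthogonal vectors of squares 1 and -1; s0, u1, u2 supply
   the other three positive directions. *)
pose v (c : R) i j := e R i + c *: e R j.
pose t : (6 + 3).-tuple n :=
  [tuple v (2^-1) ip1 il1; v (2^-1) ip2 il2; v (2^-1) ia ib;
         e R is0; e R iu1; e R iu2;
         v (- 2^-1) ip1 il1; v (- 2^-1) ip2 il2; v (- 2^-1) ia ib].
have metric_v T c i j :
    metric T (v c i j) = metric T (e R i) + c * metric T (e R j).
  by rewrite /metric /v !mxE; ring.
have vE c i j k : (v c i j 0 k = (k == i)%:R + c * (k == j)%:R).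
  by rewrite /v !mxE.
have eE i k : e R i 0 k = (k == i)%:R by rewrite mxE.
have gram (i j : 'I_(6 + 3)) : metric (tnth t i) (tnth t j) =
    if i == j then (if (i < 6)%N then 1 else -1) else 0.
  rewrite !(tnth_nth 0).
  case: i => [[|[|[|[|[|[|[|[|[|//]]]]]]]]] ?];
  case: j => [[|[|[|[|[|[|[|[|[|//]]]]]]]]] ?];
  by rewrite /= ?metric_v ?metric_e ?(vE, eE) /=; field.
have free_t : free t.
  apply: orthogonal_free metric_bilinear _ _ => [i j /negbTE ij|i].
    by rewrite gram ij.
  by rewrite gram eqxx; case: ifP; rewrite ?oppr_eq0 oner_eq0.
exists t => //; rewrite basisEfree free_t subvf size_tuple dimvf.
exact: leqnn.
Qed.

(** * The algebra of operators [calA] *)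

Lemma calA_derivation r w z : is_derivation (@lie_br R) (calA r w z).
Proof.
move=> x y.
move: (lie_br x y) (lie_brE x y) (calA r w z x) (calAE r w z x)
  (calA r w z y) (calAE r w z y) => X XE Y YE Z ZE.
move: (calA r w z X) (calAE r w z X) (lie_br Y y) (lie_brE Y y)
  (lie_br x Z) (lie_brE x Z) => U UE V VE W WE.
by apply: rV9P; rewrite !mxE UE VE WE ?(XE, YE, ZE); ring.
Qed.

Lemma calA_skew r w z : is_skew_adjoint (@metric R) (calA r w z).
Proof. by move=> x y; rewrite /metric !calAE; ring. Qed.

(** These are the relations of the oscillator algebra: w and z form a Heisenberg algebra with
    central z, and r acts on w by rotation. *)
Lemma calA_commutator r w z r' w' z' :
  (calA r w z \o calA r' w' z')%VF - (calA r' w' z' \o calA r w z)%VF =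
  calA 0 (J R *m (r *: w' - r' *: w)) (w 1 0 * w' 0 0 - w 0 0 * w' 1 0).
Proof.
set w2 := J R *m _; set z2 := w 1 0 * _ - _.
apply/lfunP => T; rewrite add_lfunE opp_lfunE !comp_lfunE.
move: (calA r w z T) (calAE r w z T) (calA r' w' z' T) (calAE r' w' z' T)
  => X XE Y YE.
move: (calA r w z Y) (calAE r w z Y) (calA r' w' z' X) (calAE r' w' z' X)
  (calA 0 w2 z2 T) (calAE 0 w2 z2 T) => U UE V VE W WE.
by apply: rV9P; rewrite !mxE UE VE WE ?mul_J /z2 ?(XE, YE) ?mxE; ring.
Qed.

Lemma calA_linear (k r z r' z' : R) (w w' : 'cV[R]_2) :
  calA (k * r + r') (k *: w + w') (k * z + z') =
  k *: calA r w z + calA r' w' z'.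
Proof.
set r2 := k * r + r'; set w2 := k *: w + w'; set z2 := k * z + z'.
apply/lfunP => T; rewrite add_lfunE scale_lfunE.
move: (calA r w z T) (calAE r w z T) (calA r' w' z' T) (calAE r' w' z' T)
  (calA r2 w2 z2 T) (calAE r2 w2 z2 T) => X XE Y YE Z ZE.
by apply: rV9P; rewrite !mxE ZE XE YE /r2 /z2 ?mxE; ring.
Qed.

Lemma col2_linear k (c d c' d' : R) :
  col2 (k * c + c') (k * d + d') = k *: col2 c d + col2 c' d'.
Proof. by apply/colP => i; rewrite !mxE; case: ifP. Qed.

Lemma col2K (w : 'cV[R]_2) : col2 (w 0 0) (w 1 0) = w.
Proof.
apply/colP => i; rewrite mxE; case: (altP (i =P 0)) => [->|i0] //.
by congr (w _ _); apply/val_inj; case: i i0 => [[|[|]]].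
Qed.

(** Packing (r, w, z) into a row of length 4 presents the operators as the image of a linear map,
    which makes them a [{vspace}] and reduces its dimension to injectivity. *)
Definition calA_of (v : 'rV[R]_4) : 'End(n) :=
  calA (v 0 0) (col2 (v 0 1) (v 0 2)) (v 0 3).

Fact calA_of_linear : linear calA_of.
Proof. by move=> k v v'; rewrite /calA_of !mxE col2_linear calA_linear. Qed.

HB.instance Definition _ :=
  GRing.isLinear.Build R 'rV[R]_4 'End(n) _ calA_of calA_of_linear.

Definition calA_space : {vspace 'End(n)} := limg (linfun calA_of).

Lemma calA_spaceP (A : 'End(n)) :
  A \in calA_space <-> exists r w z, A = calA r w z.
Proof.
split=> [/memv_imgP[v _ ->]|[r [w [z ->]]]].
  by rewrite lfunE /=; do 3!eexists.
pose v : 'rV[R]_4 := \row_i nth 0 [:: r; w 0 0; w 1 0; z] i.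
apply/memv_imgP; exists v; rewrite ?memvf // lfunE /= /calA_of.
by rewrite !mxE /= col2K.
Qed.

(** An operator determines its parameters: up to sign, the image of p2 shows r and the first entry
    of w, that of p1 the second entry of w and z. *)
Lemma dim_calA_space : \dim calA_space = 4%N.
Proof.
rewrite /calA_space limg_dim_eq ?dimvf //=.
apply/eqP; rewrite capfv -subv0; apply/subvP=> v.
rewrite memv_ker memv0 lfunE /= => /eqP A0; apply/eqP/rowP => i.
have AE T j : calA_of v T 0 j = 0 by rewrite A0 lfunE mxE.
have := AE (e R ip2) ip1; have := AE (e R ip2) is0.
have := AE (e R ip1) is0; have := AE (e R ip1) il2.
rewrite /calA_of !calAE !mxE /= => vz vw1 vw0 vr.
case: i => [[|[|[|[|//]]]] ?];
  [have vi : v 0 0 = 0 by lra | have vi : v 0 1 = 0 by lra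
  |have vi : v 0 2 = 0 by lra | have vi : v 0 3 = 0 by lra];
  by apply: etrans vi; congr (v _ _); apply/val_inj.
Qed.

Lemma calA_space_skew_derivation :
  is_skew_derivation_algebra (@lie_br R) (@metric R) calA_space.
Proof.
split=> [A /calA_spaceP[r [w [z ->]]]|A A'].
  by split; [exact: calA_derivation | exact: calA_skew].
move=> /calA_spaceP[r [w [z ->]]] /calA_spaceP[r' [w' [z' ->]]].
by apply/calA_spaceP; rewrite calA_commutator; do 3!eexists.
Qed.

(** * The geodesic graph *)

Lemma geodesic_graph_linear : linear (@geodesic_graph R).
Proof.
move=> k T T'; rewrite /geodesic_graph -calA_linear.
have -> : crd_p (k *: T + T') = k *: crd_p T + crd_p T'.
  by rewrite -col2_linear /crd_p !mxE.
have -> : crd_u (k *: T + T') = k *: crd_u T + crd_u T'.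
  by rewrite -col2_linear /crd_u !mxE.
have -> : - crd_x (k *: T + T') = k * - crd_x T + - crd_x T'.
  by rewrite /crd_x !mxE; ring.
have -> : crd_y (k *: T + T') - crd_beta (k *: T + T') =
    k * (crd_y T - crd_beta T) + (crd_y T' - crd_beta T').
  by rewrite /crd_y /crd_beta !mxE; ring.
by rewrite mulmxDr -scalemxAr scalerDr scalerN opprD addrACA.
Qed.

(** By skew-adjointness the condition reads: the product of T' with D(T)T equals that of [T, T']
    with T. Write primes for the coordinates of T'. The coefficient of l' asks for rJp = -xJp, met
    by r = -x; that of u' then asks for xw = x(-p + Ju), met by w = -p + Ju; that of p' now asks for
    (z - y)Jp = -beta Jp, met by z = y - beta. With these values the coefficients of x' and y' equal
    the dot product of p and u on both sides. *)
Lemma geodesic_graph_linear_geodesic :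
  linear_geodesic_graph (@lie_br R) (@metric R) calA_space (@geodesic_graph R).
Proof.
split=> [|T|T T']; first exact: geodesic_graph_linear.
  by apply/calA_spaceP; do 3!eexists.
rewrite /geodesic_graph /crd_x /crd_y /crd_beta.
set w := - crd_p T + _.
have w0 : w 0 0 = - T 0 ip1 + T 0 iu2 by rewrite mxE mul_J !mxE.
have w1 : w 1 0 = - T 0 ip2 - T 0 iu1 by rewrite mxE mul_J !mxE.
set r := - T 0 ia; set z := T 0 is0 - T 0 ib.
move: (lie_br T T') (lie_brE T T') (calA r w z T') (calAE r w z T')
  => X XE Y YE.
by rewrite /metric !mxE !XE !YE w0 w1 /r /z; ring.
Qed.

End RowVectors.

Theorem theorem3 (R : realType) :
  [/\ is_lie_bracket (@lie_br R),
      is_metric (@metric R) &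
      has_signature (@metric R) 6 3] /\
  [/\ step_nilpotent (@lie_br R) 4,
      is_GO (@lie_br R) (@metric R) &
      exists h : {vspace 'End('rV[R]_9)},
        [/\ (forall A : 'End('rV[R]_9),
               A \in h <->
               exists (r : R) (w : 'cV[R]_2) (z : R), A = calA r w z),
            \dim h = 4%N,
            is_skew_derivation_algebra (@lie_br R) (@metric R) h &
            linear_geodesic_graph (@lie_br R) (@metric R) h
              (@geodesic_graph R)]].
Proof.
have [_ Dh DT] := geodesic_graph_linear_geodesic R.
split; split.
- exact: lie_br_lie.
- exact: metric_nondegenerate.
- exact: metric_signature.
- exact: lie_br_step_nilpotent.
- exists (calA_space R); split; first exact: calA_space_skew_derivation.
  move=> T; exists (geodesic_graph T), 0; split=> // T'.
  by rewrite DT mul0r.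
- exists (calA_space R); split.
  + exact: calA_spaceP.
  + exact: dim_calA_space.
  + exact: calA_space_skew_derivation.
  + exact: geodesic_graph_linear_geodesic.
Qed.
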